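(* Let $\mathcal{C}$ be a congruence-modular equational class of algebras, let $A$ be an algebra from $\mathcal{C}$, and let $\phi \in \mathrm{Con}(A)$ be such that $[\phi,\phi]_A=\phi$. Then: (1) if $\phi$ is strictly meet-irreducible in $\mathrm{Con}(A)$ and $[\phi^+,\phi^+]_A\neq \phi$, then $\phi\in \mathrm{Spec}(A)$; (2) if $\phi\in \mathrm{Spec}(A)$, then $\phi$ is proper and meet-irreducible in $\mathrm{Con}(A)$, and $[\alpha,\beta]_A\neq\phi$ for any $\alpha,\beta\in \mathrm{Con}(A)$ such that $\phi\subsetneq\alpha$ and $\phi\subsetneq\beta$; (3) if the principal filter $[\phi)=\{\gamma\in \mathrm{Con}(A) : \phi\subseteq\gamma\}$ is finite, then the following three conditions are equivalent: (a) $\phi\in \mathrm{Spec}(A)$; (b) $\phi$ is strictly meet-irreducible and $[\phi^+,\phi^+]_A\neq\phi$; (c) $\phi$ is proper and meet-irreducible and $[\alpha,\beta]_A\neq\phi$ for any $\alpha,\beta\in \mathrm{Con}(A)$ such that $\phi\subsetneq\alpha$ and $\phi\subsetneq\beta$; (4) if $\mathrm{Con}(A)$ is finite, then the same three conditions (a), (b), (c) listed in (3) are equivalent.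
   Context: All algebras are non-empty. $\mathrm{Con}(M)$ is the lattice of congruences of an algebra $M$ ordered by inclusion, with greatest element $\nabla_M=M^2$; a congruence is proper if it differs from $\nabla_M$. An equational class (variety) is congruence-modular if $\mathrm{Con}(M)$ is a modular lattice for each of its members $M$. In a congruence-modular equational class, $[\alpha,\beta]_M$ denotes the (Freese–McKenzie) commutator of $\alpha,\beta\in \mathrm{Con}(M)$: the least $\delta\in \mathrm{Con}(M)$ such that for all $m,n$, every $(m+n)$-ary term $t$, all $(a_i,b_i)\in\alpha$ ($1\le i\le m$) and all $(c_j,d_j)\in\beta$ ($1\le j\le n$), $(t(\bar a,\bar c),t(\bar a,\bar d))\in\delta$ implies $(t(\bar b,\bar c),t(\bar b,\bar d))\in\delta$. A proper congruence $\phi$ of $A$ is prime if, for all $\alpha,\beta\in \mathrm{Con}(A)$, $[\alpha,\beta]_A\subseteq\phi$ implies $\alpha\subseteq\phi$ or $\beta\subseteq\phi$; $\mathrm{Spec}(A)$ is the set of prime congruences of $A$. An element $x$ of a lattice $L$ is meet-irreducible if $x=a\wedge b$ implies $x=a$ or $x=b$; it is strictly meet-irreducible if $\min\{y\in L : x<y\}$ exists, in which case this minimum is denoted $x^+$. *)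

(* Defs.v *)
From HB Require Import structures.
From mathcomp Require Import all_boot all_order.
From mathcomp Require Import boolp classical_sets cardinality.

Set Implicit Arguments.
Unset Strict Implicit.
Unset Printing Implicit Defensive.

Import Order.TTheory.
Local Open Scope classical_set_scope.
Local Open Scope order_scope.

Definition modular_lattice d (L : latticeType d) : Prop :=
  forall x y z : L, x <= z -> x `|` (y `&` z) = (x `|` y) `&` z.

Definition meet_irreducible d (L : latticeType d) (x : L) : Prop :=
  forall a b : L, x = a `&` b -> x = a \/ x = b.

Definition is_minimum d (L : porderType d) (P : set L) (y : L) : Prop :=
  P y /\ lbound P y.

Definition strictly_meet_irreducible d (L : latticeType d) (x : L) : Prop :=
  exists y, is_minimum [set y | x < y] y.

(* The element x^+; its value is the junk value x if x is not strictly
   meet-irreducible. *)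
Definition upper_cover d (L : latticeType d) (x : L) : L :=
  xget x (is_minimum [set y | x < y]).

Lemma upper_coverP d (L : latticeType d) (x : L) :
  strictly_meet_irreducible x -> is_minimum [set y | x < y] (upper_cover x).
Proof. by case=> y Py; apply: (xgetPex x); exists y. Qed.

Record signature := Signature { symbol : Type; arity : symbol -> nat }.

Record algebra (S : signature) := Algebra {
  carrier :> Type;
  carrier_inhabited : inhabited carrier;
  op : forall f : symbol S, ('I_(arity f) -> carrier) -> carrier }.

Inductive term (S : signature) (V : Type) :=
| Var of V
| App (f : symbol S) of ('I_(arity f) -> term S V).

Fixpoint eval (S : signature) (V : Type) (M : algebra S) (v : V -> M)
    (t : term S V) : M :=
  match t with
  | Var x => v x
  | App f ts => op (fun i => eval v (ts i))
  end.

Definition satisfies (S : signature) (M : algebra S)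
    (E : set (term S nat * term S nat)) : Prop :=
  forall s t, E (s, t) -> forall v : nat -> M, eval v s = eval v t.

Definition equational_class (S : signature) (C : algebra S -> Prop) : Prop :=
  exists E, forall M, C M <-> satisfies M E.

Record is_congruence (S : signature) (M : algebra S) (r : M -> M -> Prop) :
    Prop :=
  IsCongruence {
    congr_refl : forall x, r x x;
    congr_sym : forall x y, r x y -> r y x;
    congr_trans : forall x y z, r x y -> r y z -> r x z;
    congr_op : forall (f : symbol S) (a b : 'I_(arity f) -> M),
      (forall i, r (a i) (b i)) -> r (op a) (op b) }.

Record Con (S : signature) (M : algebra S) := MkCon {
  con_rel :> M -> M -> Prop;
  conP : is_congruence con_rel }.

Lemma con_inj (S : signature) (M : algebra S) : injective (@con_rel S M).
Proof. by move=> [r rP] [s sP] /= rs; subst s; congr MkCon. Qed.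

Lemma inter_is_congruence (S : signature) (M : algebra S) (P : set (Con M)) :
  is_congruence (fun x y => forall t : Con M, P t -> t x y).
Proof.
split=> /=.
- by move=> x t _; apply: (congr_refl (conP t)).
- by move=> x y xy t Pt; apply: (congr_sym (conP t)); apply: xy.
- move=> x y z xy yz t Pt.
  by apply: (congr_trans (conP t) (xy t Pt)); apply: yz.
- by move=> f a b ab t Pt; apply: (congr_op (conP t)) => i; apply: ab.
Qed.

Definition con_inter (S : signature) (M : algebra S) (P : set (Con M)) : Con M :=
  MkCon (inter_is_congruence P).

Lemma meet_is_congruence (S : signature) (M : algebra S) (r s : Con M) :
  is_congruence (fun x y => r x y /\ s x y).
Proof.
case: (conP r) (conP s) => r1 r2 r3 r4 [s1 s2 s3 s4]; split=> /=.
- by move=> x; split.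
- by move=> x y [/r2 ? /s2 ?]; split.
- move=> x y z [xy xy'] [yz yz'].
  by split; [apply: r3 xy yz|apply: s3 xy' yz'].
- by move=> f a b ab; split; [apply: r4|apply: s4] => i; case: (ab i).
Qed.

Definition con_meet (S : signature) (M : algebra S) (r s : Con M) : Con M :=
  MkCon (meet_is_congruence r s).

Definition con_join (S : signature) (M : algebra S) (r s : Con M) : Con M :=
  con_inter [set t : Con M | (forall x y, r x y -> t x y) /\
                             (forall x y, s x y -> t x y)].

Lemma full_is_congruence (S : signature) (M : algebra S) :
  is_congruence (fun _ _ : M => True).
Proof. by []. Qed.

Definition con_full (S : signature) (M : algebra S) : Con M :=
  MkCon (@full_is_congruence S M).

Fact con_display : Order.disp_t. Proof. exact: (Order.Disp tt tt). Qed.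

HB.instance Definition _ (S : signature) (M : algebra S) := gen_eqMixin (Con M).
HB.instance Definition _ (S : signature) (M : algebra S) :=
  gen_choiceMixin (Con M).

Definition con_le (S : signature) (M : algebra S) (r s : Con M) : bool :=
  `[< forall x y, r x y -> s x y >].

Fact con_le_refl (S : signature) (M : algebra S) : reflexive (@con_le S M).
Proof. by move=> r; apply/asboolP. Qed.

Fact con_le_anti (S : signature) (M : algebra S) : antisymmetric (@con_le S M).
Proof.
move=> r s /andP[/asboolP rs /asboolP sr]; apply/con_inj/funext => x; apply/funext => y.
by apply/propext; split; [apply: rs|apply: sr].
Qed.

Fact con_le_trans (S : signature) (M : algebra S) : transitive (@con_le S M).
Proof.
by move=> s r t /asboolP rs /asboolP st; apply/asboolP => x y /rs /st.
Qed.

HB.instance Definition _ (S : signature) (M : algebra S) :=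
  Order.Le_isPOrder.Build con_display (Con M)
    (@con_le_refl S M) (@con_le_anti S M) (@con_le_trans S M).

Lemma con_leP (S : signature) (M : algebra S) (r s : Con M) :
  reflect (forall x y, r x y -> s x y) (r <= s).
Proof. exact: asboolP. Qed.

Fact con_lexI (S : signature) (M : algebra S) (x y z : Con M) :
  (x <= con_meet y z) = (x <= y) && (x <= z).
Proof.
apply/con_leP/andP => [h|[/con_leP xy /con_leP xz] p q xpq].
  by split; apply/con_leP => p q /h [].
by split; [apply: xy|apply: xz].
Qed.

Fact con_leUx (S : signature) (M : algebra S) (x y z : Con M) :
  (con_join x y <= z) = (x <= z) && (y <= z).
Proof.
apply/con_leP/andP => [h|[/con_leP xz /con_leP yz] p q].
  by split; apply/con_leP => p q xpq; apply: h => t /= [xt yt];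
    [apply: xt|apply: yt].
by apply.
Qed.

Fact con_lex1 (S : signature) (M : algebra S) (x : Con M) : x <= con_full M.
Proof. exact/con_leP. Qed.

HB.instance Definition _ (S : signature) (M : algebra S) :=
  Order.POrder_isMeetSemilattice.Build con_display (Con M) (@con_lexI S M).
HB.instance Definition _ (S : signature) (M : algebra S) :=
  Order.POrder_isJoinSemilattice.Build con_display (Con M) (@con_leUx S M).
HB.instance Definition _ (S : signature) (M : algebra S) :=
  Order.hasTop.Build con_display (Con M) (@con_lex1 S M).

Definition proper_congruence (S : signature) (M : algebra S) (r : Con M) : Prop :=
  r <> \top.

Definition congruence_modular (S : signature) (C : algebra S -> Prop) : Prop :=
  forall M, C M -> modular_lattice (Con M).

Definition join_args (T : Type) (m n : nat) (a : 'I_m -> T) (c : 'I_n -> T)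
    (i : 'I_(m + n)) : T :=
  match split i with inl j => a j | inr k => c k end.

Definition term_condition (S : signature) (M : algebra S)
    (alpha beta delta : Con M) : Prop :=
  forall (m n : nat) (t : term S 'I_(m + n))
      (a b : 'I_m -> M) (c d : 'I_n -> M),
    (forall i, alpha (a i) (b i)) -> (forall j, beta (c j) (d j)) ->
    delta (eval (join_args a c) t) (eval (join_args a d) t) ->
    delta (eval (join_args b c) t) (eval (join_args b d) t).

Definition commutator (S : signature) (M : algebra S) (alpha beta : Con M) :
    Con M :=
  con_inter (term_condition alpha beta).

(* The term condition is stable under intersections, so that the intersection
   above is indeed the least congruence satisfying it. *)
Lemma commutator_least (S : signature) (M : algebra S) (alpha beta : Con M) :
  is_minimum (term_condition alpha beta) (commutator alpha beta).
Proof.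
split=> [m n t a b c d ab cd h delta deltaP|delta deltaP].
  by apply: (deltaP m n t a b c d ab cd); apply: h.
by apply/con_leP => p q; apply.
Qed.

Definition prime_congruence (S : signature) (M : algebra S) (phi : Con M) : Prop :=
  proper_congruence phi /\
  forall alpha beta : Con M,
    commutator alpha beta <= phi -> alpha <= phi \/ beta <= phi.

Definition Spec (S : signature) (M : algebra S) : set (Con M) :=
  [set phi | prime_congruence phi].

Arguments Spec {S} M.

(* Main.v *)
(* Everything rests on the equivalence of [alpha, beta] <= phi and the term
   condition C(alpha, beta; phi), together with the symmetry of the latter; both
   hold in congruence-modular classes.  They follow from the fact that the
   weakening of C(beta, alpha; phi) whose premise is an equality, which is
   monotone in phi, already implies C(alpha, beta; phi).  This is proved without
   Day terms, by applying the modular law to an algebra of 2 x 2 matrices over A.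
   Since C(phi, beta; phi) always holds and the term condition is preserved by
   joins in its first argument, [alpha, beta] <= phi yields
   [alpha v phi, beta v phi] <= phi.  If phi is strictly meet-irreducible and
   neither alpha nor beta is below phi, then [phi^+, phi^+] is squeezed between
   [phi, phi] = phi and phi.  In (3) and (4) finiteness turns meet-irreducible
   into strictly meet-irreducible. *)
Require Import Defs.
From Stdlib Require Import Relation_Operators.
From HB Require Import structures.
From mathcomp Require Import all_boot all_order.
From mathcomp Require Import boolp classical_sets cardinality.

Import Order.TTheory.
Local Open Scope classical_set_scope.
Local Open Scope order_scope.

Set Implicit Arguments.
Unset Strict Implicit.
Unset Printing Implicit Defensive.

(** * Changing tuples one coordinate at a time *)

Definition update (T : Type) (n : nat) (a : 'I_n -> T) (i : 'I_n) (x : T) :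
    'I_n -> T :=
  fun j => if j == i then x else a j.

Lemma coordinatewise_path (T : Type) (n : nat) (step : T -> T -> Prop)
    (R : ('I_n -> T) -> ('I_n -> T) -> Prop) (a b : 'I_n -> T) :
  (forall u, R u u) -> (forall u v w, R u v -> R v w -> R u w) ->
  (forall u i x y, step x y -> R (update u i x) (update u i y)) ->
  (forall i, clos_refl_trans T step (a i) (b i)) -> R a b.
Proof.
move=> Rrefl Rtrans Rstep ab.
have Rupd u i x y : clos_refl_trans T step x y ->
    R (update u i x) (update u i y).
  by elim=> {x y} [x y /Rstep//|//|x y z _ + _]; apply: Rtrans.
(* [w k] follows [b] on the first [k] coordinates and [a] on the others, so [w 0] is [a] and [w n]
   is [b]. *)
pose w k (i : 'I_n) := if (i < k)%N then b i else a i.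
have aw k : (k <= n)%N -> R a (w k).
  elim: k => [_|k IHk kn]; first by rewrite (_ : w 0 = a) //; apply/funext.
  apply: Rtrans (IHk (ltnW kn)) _.
  have := Rupd (w k) (Ordinal kn) _ _ (ab (Ordinal kn)).
  congr R; apply/funext => i; rewrite /update /w -val_eqE /= ?ltnS.
    by case: eqP => // ik; rewrite ik ltnn; congr a; apply: val_inj.
  rewrite [(i <= k)%N]leq_eqVlt; case: eqP => //= ik.
  by congr b; apply: val_inj.
by have := aw n (leqnn n); congr R; apply/funext => i; rewrite /w ltn_ord.
Qed.

(** * Renaming of variables and blocks of arguments *)

Section TermRenaming.
Variables (S : signature) (V W : Type) (M : algebra S).

Fixpoint rename (r : V -> W) (t : term S V) : term S W :=
  match t with
  | Var x => Var S (r x)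
  | App f ts => App (fun i => rename r (ts i))
  end.

Lemma eval_rename (r : V -> W) (v : W -> M) (t : term S V) :
  eval v (rename r t) = eval (fun x => v (r x)) t.
Proof. by elim: t => //= f ts IH; congr op; apply/funext. Qed.

End TermRenaming.

Section JoinArgs.
Variables (T : Type) (m n : nat).

Lemma join_args_lshift (a : 'I_m -> T) (c : 'I_n -> T) i :
  join_args a c (lshift n i) = a i.
Proof. by rewrite /join_args (unsplitK (inl i)). Qed.

Lemma join_args_rshift (a : 'I_m -> T) (c : 'I_n -> T) j :
  join_args a c (rshift m j) = c j.
Proof. by rewrite /join_args (unsplitK (inr j)). Qed.

Lemma comp_join_args (T' : Type) (v : T -> T') (a : 'I_m -> T) (c : 'I_n -> T) :
  (fun i => v (join_args a c i)) = join_args (fun i => v (a i)) (fun j => v (c j)).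
Proof. by apply/funext => i; rewrite /join_args; case: split. Qed.

End JoinArgs.

(** * Joins of congruences *)

Section Congruences.
Variables (S : signature) (M : algebra S).
Implicit Types r s : Con M.

Lemma con_eval (V : Type) r (v w : V -> M) (t : term S V) :
  (forall x, r (v x) (w x)) -> r (eval v t) (eval w t).
Proof. by move=> vw; elim: t => //= f ts IH; apply: (congr_op (conP r)). Qed.

(** The closure of the union is itself a congruence above [r] and [s]: changing one argument of an
    operation at a time makes it compatible with the operations. *)
Lemma con_joinE r s x y :
  (r `|` s) x y -> clos_refl_trans M (fun x y => r x y \/ s x y) x y.
Proof.
set T := clos_refl_trans M _.
have Tsym u v : T u v -> T v u.
  elim=> {u v} [u v uv|u|u v w _ vu _ wv]; last exact: rt_trans wv vu.
    apply: rt_step.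
    by case: uv => uv; [left|right]; apply: (congr_sym (conP _)).
  exact: rt_refl.
have Tcon : is_congruence T.
  split=> [u|//|u v w|f a b ab]; [exact: rt_refl|exact: rt_trans|].
  apply: (coordinatewise_path (R := fun u v => T (op u) (op v)) _ _ _ ab).
  - by move=> u; apply: rt_refl.
  - by move=> u v w; apply: rt_trans.
  - move=> u i p q pq; apply: rt_step.
    by case: pq => pq; [left|right]; apply: (congr_op (conP _)) => j;
      rewrite /update; case: (j == i) => //; apply: (congr_refl (conP _)).
by move=> /(_ (MkCon Tcon)); apply; split=> p q pq; apply: rt_step; [left|right].
Qed.

Lemma joinWl r s x y : r x y -> (r `|` s) x y.
Proof. by move: x y; apply/con_leP; apply: leUl. Qed.

Lemma joinWr r s x y : s x y -> (r `|` s) x y.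
Proof. by move: x y; apply/con_leP; apply: leUr. Qed.

Lemma eq_is_congruence : is_congruence (@eq M).
Proof.
split=> //; first by move=> x y z -> ->.
by move=> f a b ab; congr op; apply/funext.
Qed.

Definition con_eq : Con M := MkCon eq_is_congruence.

End Congruences.

(** * Subalgebras of powers *)

Section Subpower.
Variables (S : signature) (A : algebra S) (I : Type) (K : (I -> A) -> Prop).
Hypothesis K_inhabited : exists g, K g.
Hypothesis K_op : forall f (ts : 'I_(arity f) -> I -> A),
  (forall k, K (ts k)) -> K (fun i => op (fun k => ts k i)).

Lemma subpower_inhabited : inhabited {g | K g}.
Proof. by case: K_inhabited => g Kg; exists; exists g. Qed.

Definition subpower : algebra S :=
  Algebra subpower_inhabited
    (fun f (ts : 'I_(arity f) -> {g | K g}) =>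
       exist K _ (K_op (fun k => svalP (ts k)))).

Lemma eval_subpower (V : Type) (v : V -> subpower) (t : term S V) (i : I) :
  sval (eval v t) i = eval (fun x => sval (v x) i) t.
Proof. by elim: t => //= f ts IH; congr op; apply/funext. Qed.

Lemma equational_class_subpower (C : algebra S -> Prop) :
  equational_class C -> C A -> C subpower.
Proof.
move=> [E CE] /CE AE; apply/CE => s t /AE st v.
apply: eq_sig_hprop => [g|]; first exact: Prop_irrelevance.
by apply/funext => i; rewrite !eval_subpower.
Qed.

Lemma coord_is_congruence (i : I) (r : Con A) :
  is_congruence (fun P Q : subpower => r (sval P i) (sval Q i)).
Proof.
split=> [P|P Q|P Q R|f a b ab].
- exact: (congr_refl (conP r)).
- exact: (congr_sym (conP r)).
- exact: (congr_trans (conP r)).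
- exact: (congr_op (conP r)).
Qed.

Definition coord_con (i : I) (r : Con A) : Con subpower :=
  MkCon (coord_is_congruence i r).

End Subpower.

(** * Symmetry and monotonicity of the term condition *)

Section TermCondition.
Variables (S : signature) (C : algebra S -> Prop).
Hypotheses (C_equational : equational_class C) (C_modular : congruence_modular C).
Variable A : algebra S.
Hypothesis A_in_C : C A.
Implicit Types alpha beta phi psi : Con A.

(* Compared with [term_condition beta alpha phi], the premise of the implication
   is an equality instead of membership in [phi], so that the condition is
   monotone in [phi]. *)
Definition weak_term_condition alpha beta phi : Prop :=
  forall (m n : nat) (t : term S 'I_(m + n))
      (a b : 'I_m -> A) (c d : 'I_n -> A),
    (forall i, alpha (a i) (b i)) -> (forall j, beta (c j) (d j)) ->
    eval (join_args a c) t = eval (join_args b c) t ->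
    phi (eval (join_args a d) t) (eval (join_args b d) t).

(** Exchanging the two blocks of variables of [t] exchanges the roles of the congruences; the
    equality enters the premise by reflexivity of [phi]. *)
Lemma term_condition_weak alpha beta phi :
  term_condition beta alpha phi -> weak_term_condition alpha beta phi.
Proof.
move=> tc m n t a b c d ab cd eq_t.
pose r := join_args (@rshift n m) (@lshift n m).
have swap u v : eval (join_args u v) t = eval (join_args v u) (rename r t).
  rewrite eval_rename comp_join_args; congr eval; congr join_args.
    by apply/funext => i; rewrite join_args_rshift.
  by apply/funext => i; rewrite join_args_lshift.
rewrite !swap; apply: (tc _ _ _ c d a b) => //.
by rewrite -!swap eq_t; apply: (congr_refl (conP phi)).
Qed.

(* The modular law is applied in the algebra of matrices
   [[s(b,c), s(b,d)], [s(a,c), s(a,d)]], whose entries are indexed by (p, q),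
   to the matrices U = t(b,c), X = t(p,c), Y = t(p,q), V = t(b,q). *)
Lemma weak_term_conditionP alpha beta phi :
  weak_term_condition alpha beta phi -> term_condition alpha beta phi.
Proof.
move=> weak m n t a b c d ab cd xy.
(* Each block is doubled: its left half varies with [p] or [q], its right half stays at [b] or [c].
   Hence constant entries are term values too. *)
pose args (pq : bool * bool) : 'I_((m + m) + (n + n)) -> A :=
  join_args (join_args (if pq.1 then a else b) b)
            (join_args (if pq.2 then d else c) c).
pose K (g : bool * bool -> A) := exists s, g = fun pq => eval (args pq) s.
pose elt l r :=
  rename (join_args (fun i => @lshift (m + m) (n + n) (l i))
                    (fun j => @rshift (m + m) (n + n) (r j))) t.
have Kelt l r : K (fun pq => eval (args pq) (elt l r)) by exists (elt l r).
have K_inh := ex_intro K _ (Kelt (@lshift m m) (@lshift n n)).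
have K_op f (ts : 'I_(arity f) -> bool * bool -> A) :
    (forall k, K (ts k)) -> K (fun i => op (fun k => ts k i)).
  move=> /choice[s tsE]; exists (App s); apply/funext => pq /=.
  by congr op; apply/funext => k; rewrite tsE.
pose B := subpower K_inh K_op.
have modB : modular_lattice (Con B).
  exact/C_modular/(equational_class_subpower K_inh K_op C_equational).
pose E pq : Con B := coord_con K_inh K_op pq (con_eq A).
(* [rho] is equality on the row p = b, [sigma] equality on the column q = c; [gam] adds to [sigma]
   that the (a, d) entries are related by [phi]. *)
pose rho := E (false, false) `&` E (false, true).
pose sigma := E (false, false) `&` E (true, false).
pose gam := sigma `&` coord_con K_inh K_op (true, true) phi.
pose mk l r : B := exist K _ (Kelt l r).
have mkE l r pq : sval (mk l r) pq =
    eval (join_args (fun i => join_args (if pq.1 then a else b) b (l i))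
                    (fun j => join_args (if pq.2 then d else c) c (r j))) t.
  rewrite /= eval_rename comp_join_args /args; congr eval.
  by congr join_args; apply/funext => i;
    rewrite ?join_args_lshift ?join_args_rshift.
have sl k (u v : 'I_k -> A) : (fun i => join_args u v (lshift k i)) = u.
  by apply/funext => i; rewrite join_args_lshift.
have sr k (u v : 'I_k -> A) : (fun i => join_args u v (rshift k i)) = v.
  by apply/funext => i; rewrite join_args_rshift.
pose U := mk (@rshift m m) (@rshift n n).
pose X := mk (@lshift m m) (@rshift n n).
pose Y := mk (@lshift m m) (@lshift n n).
pose V := mk (@rshift m m) (@lshift n n).
have UE pq : sval U pq = eval (join_args b c) t by rewrite mkE !sr.
have XE pq : sval X pq = eval (join_args (if pq.1 then a else b) c) t.
  by rewrite mkE sl sr.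
have YE pq : sval Y pq =
    eval (join_args (if pq.1 then a else b) (if pq.2 then d else c)) t.
  by rewrite mkE !sl.
have VE pq : sval V pq = eval (join_args b (if pq.2 then d else c)) t.
  by rewrite mkE sl sr.
have EI pq (P Q : B) : sval P pq = sval Q pq -> E pq P Q by [].
have UV : (gam `|` (rho `&` sigma)) U V.
  (* As [gam] is below [sigma], it suffices to have [U] related to [V] by [sigma] and joined to it
     by the path [U] [rho] [X] [gam] [Y] [rho] [V]; the middle step is the hypothesis [xy]. *)
  rewrite modB; last exact: leIl.
  split; last by split; apply: EI; rewrite UE VE.
  apply: (congr_trans (conP _) (y := X)).
    by apply: joinWr; split; apply: EI; rewrite UE XE.
  apply: (congr_trans (conP _) (y := Y)).
    apply: joinWl; split; first by split; apply: EI; rewrite XE YE.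
    by change (phi (sval X (true, true)) (sval Y (true, true))); rewrite XE YE.
  by apply: joinWr; split; apply: EI; rewrite YE VE.
(* Every matrix on a path from U to V has constant column q = c, so the weak
   term condition relates its two entries in the column q = d. *)
have col (P : B) : sigma U P -> phi (sval P (true, true)) (sval P (false, true)).
  case: P => g [s gE] [/= e1 e2]; rewrite gE.
  apply: (weak _ _ s _ _ (join_args c c)).
  - move=> i; rewrite /join_args; case: split => k //.
    exact: (congr_refl (conP alpha)).
  - move=> j; rewrite /join_args; case: split => k //.
    exact: (congr_refl (conP beta)).
  - move: e1 e2; rewrite gE /args /= => <- <-.
    by have := UE (true, false); have := UE (false, false); rewrite /= => -> ->.
(* A [gam] step keeps the (a, d) entry within [phi] by definition. A step of [rho] and [sigma] fixes
   the (b, d) entry, to which [col] links the (a, d) entries of both ends. *)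
have path (P Q : B) :
    clos_refl_trans B (fun P Q => gam P Q \/ (rho `&` sigma) P Q) P Q ->
    sigma U P -> sigma U Q /\ phi (sval P (true, true)) (sval Q (true, true)).
  elim=> {P Q} [P Q|P UP|P Q R _ IH1 _ IH2 UP].
  - case=> [[PQ phiPQ] UP|[[_ PQ] sPQ] UP].
      by split=> //; apply: (congr_trans (conP sigma)) UP PQ.
    have UQ := congr_trans (conP sigma) UP sPQ.
    split=> //; apply: (congr_trans (conP phi)) (col P UP) _.
    by rewrite [sval P _]PQ; apply: (congr_sym (conP phi)); apply: col.
  - by split=> //; apply: (congr_refl (conP phi)).
  - have [UQ PQ] := IH1 UP; have [UR QR] := IH2 UQ.
    by split=> //; apply: (congr_trans (conP phi)) PQ QR.
have [|_] := path U V (con_joinE UV); first exact: (congr_refl (conP sigma)).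
by rewrite UE VE.
Qed.

Lemma term_condition_sym_ge alpha beta phi psi : psi <= phi ->
  term_condition alpha beta psi -> term_condition beta alpha phi.
Proof.
move=> /con_leP le_phi /term_condition_weak weak.
apply: weak_term_conditionP => m n t a b c d ab cd h.
exact/le_phi/(weak _ _ _ _ _ c).
Qed.

(** The commutator satisfies the term condition; two uses of symmetry carry it up to [phi] and
    restore the order of the arguments. *)
Lemma commutator_leP alpha beta phi :
  commutator alpha beta <= phi <-> term_condition alpha beta phi.
Proof.
have [tc least] := commutator_least alpha beta; split; last exact: least.
by move=> /term_condition_sym_ge/(_ tc); apply: term_condition_sym_ge.
Qed.

End TermCondition.

(** * Elementary properties of the term condition and the commutator *)

Section TermConditionBasics.
Variables (S : signature) (A : algebra S).
Implicit Types alpha beta phi : Con A.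

(** The implication in the term condition composes along a path from [a] to [b] that changes one
    argument at a time by [alpha1] or [alpha2]. *)
Lemma term_condition_joinl alpha1 alpha2 beta phi :
  term_condition alpha1 beta phi -> term_condition alpha2 beta phi ->
  term_condition (alpha1 `|` alpha2) beta phi.
Proof.
move=> tc1 tc2 m n t a b c d ab cd.
have {}ab i := con_joinE (ab i).
pose R u v := phi (eval (join_args u c) t) (eval (join_args u d) t) ->
  phi (eval (join_args v c) t) (eval (join_args v d) t).
apply: (coordinatewise_path (R := R) _ _ _ ab); rewrite /R; [by []|by auto|].
move=> u i x y xy.
by case: xy => xy; [apply: tc1 => //|apply: tc2 => //] => j; rewrite /update;
  case: (j == i) => //; apply: (congr_refl (conP _)).
Qed.

Lemma term_condition_le alpha alpha' beta beta' phi :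
  alpha <= alpha' -> beta <= beta' ->
  term_condition alpha' beta' phi -> term_condition alpha beta phi.
Proof.
move=> /con_leP aa' /con_leP bb' tc m n t a b c d ab cd.
by apply: tc => i; [apply: aa'|apply: bb'].
Qed.

Lemma term_condition_l alpha beta : term_condition alpha beta alpha.
Proof.
move=> m n t a b c d ab cd h.
(* The two sides of a rectangle: t(b,c), t(a,c), t(a,d), t(b,d) are consecutively related by
   [alpha]. *)
have E v : alpha (eval (join_args a v) t) (eval (join_args b v) t).
  apply: con_eval => i; rewrite /join_args; case: split => // k.
  exact: (congr_refl (conP alpha)).
apply: (congr_trans (conP alpha)) (E d).
by apply: (congr_trans (conP alpha)) h; apply: (congr_sym (conP alpha)).
Qed.

Lemma term_condition_r alpha beta : term_condition alpha beta beta.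
Proof.
move=> m n t a b c d ab cd _.
apply: con_eval => i; rewrite /join_args; case: split => // k.
exact: (congr_refl (conP beta)).
Qed.

Lemma commutator_leI alpha beta : commutator alpha beta <= alpha `&` beta.
Proof.
have [_ least] := commutator_least alpha beta.
rewrite lexI; apply/andP; split; apply: least.
  exact: term_condition_l.
exact: term_condition_r.
Qed.

Lemma commutator_le alpha alpha' beta beta' :
  alpha <= alpha' -> beta <= beta' ->
  commutator alpha beta <= commutator alpha' beta'.
Proof.
move=> aa' bb'; apply: (commutator_least _ _).2; apply: term_condition_le aa' bb' _.
exact: (commutator_least _ _).1.
Qed.

End TermConditionBasics.

(** * Meet-irreducible elements and prime congruences *)

Lemma finite_strictly_meet_irreducible d (L : tLatticeType d) (x : L) :
  finite_set [set y | x <= y] -> x <> \top -> meet_irreducible x ->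
  strictly_meet_irreducible x.
Proof.
move=> /finite_seqP[s sE] /eqP xT irr.
(* Meet-irreducibility keeps every partial meet strictly above [x]; the empty meet is the top, which
   differs from [x]. *)
have min_gt : x < \meet_(y <- s | x < y) y.
  elim/big_rec: _ => [|y z xy xz]; first by rewrite lt_neqAle xT lex1.
  rewrite lt_neqAle lexI (ltW xy) (ltW xz) !andbT; apply/eqP.
  by move=> /irr[] xE; [move: xy|move: xz]; rewrite -xE ltxx.
exists (\meet_(y <- s | x < y) y); split=> // y /= xy.
apply: meets_inf_seq => //.
by have : [set` s] y by rewrite -sE /=; apply: ltW.
Qed.

Section Prime.
Variables (S : signature) (A : algebra S).
Implicit Types alpha beta phi : Con A.

(** The commutator of [a] and [b] lies below their meet [phi], so primeness puts one of them below
    [phi]. *)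
Lemma prime_meet_irreducible phi : Spec A phi -> meet_irreducible phi.
Proof.
move=> [_ prime] a b phiE.
have := prime a b; rewrite [X in _ <= X]phiE => /(_ (commutator_leI a b)).
by case=> le; [left|right]; apply/le_anti; rewrite {1}phiE le
  ?leIl ?leIr.
Qed.

Lemma prime_commutator_neq phi alpha beta :
  Spec A phi -> phi < alpha -> phi < beta -> commutator alpha beta <> phi.
Proof.
move=> [_ prime] pa pb E; have := prime alpha beta; rewrite E lexx => /(_ isT).
by rewrite (lt_geF pa) (lt_geF pb); case.
Qed.

Lemma strictly_meet_irreducible_prime (C : algebra S -> Prop) phi :
  equational_class C -> congruence_modular C -> C A ->
  commutator phi phi = phi -> strictly_meet_irreducible phi ->
  commutator (upper_cover phi) (upper_cover phi) <> phi -> Spec A phi.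
Proof.
move=> Ceq Cmod CA idem /upper_coverP[/= lt_cover cover_min] neq.
split=> [phiT|alpha beta ab].
  by have := lt_le_trans lt_cover (lex1 _); rewrite phiT ltxx.
have cover_le gam : ~ gam <= phi -> upper_cover phi <= gam `|` phi.
  move=> gphi; apply: cover_min => /=; rewrite lt_neqAle leUr andbT.
  by apply/eqP => E; apply: gphi; rewrite E leUl.
apply: contrapT => /not_orP[/cover_le ca /cover_le cb].
apply: neq; apply/le_anti/andP; split; last first.
  by rewrite -{1}idem; apply: commutator_le; apply: ltW.
have cP := commutator_leP Ceq Cmod CA; apply/cP.
have sym := term_condition_sym_ge Ceq Cmod CA (lexx phi).
(* The cover is enlarged to [beta] v [phi] on the left and [alpha] v [phi] on the right. Each join
   is split on the left, with a swap in between, leaving the pair [alpha], [beta]. *)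
apply: term_condition_le cb ca _.
apply: term_condition_joinl; last exact: term_condition_l.
apply: sym; apply: term_condition_joinl; last exact: term_condition_l.
exact/cP.
Qed.

End Prime.

Unset Implicit Arguments.

Theorem proposition3p4 (S : signature) (C : algebra S -> Prop)
    (C_equational : equational_class C) (C_modular : congruence_modular C)
    (A : algebra S) (A_in_C : C A)
    (phi : Con A) (phi_idem : commutator phi phi = phi) :
  (* (1) *)
  (strictly_meet_irreducible phi ->
   commutator (upper_cover phi) (upper_cover phi) <> phi ->
   Spec A phi) /\
  (* (2) *)
  (Spec A phi ->
   proper_congruence phi /\ meet_irreducible phi /\
   (forall alpha beta : Con A, phi < alpha -> phi < beta ->
      commutator alpha beta <> phi)) /\
  (* (3) *)
  (finite_set [set gamma : Con A | phi <= gamma] ->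
   [<-> Spec A phi;
        strictly_meet_irreducible phi /\
          commutator (upper_cover phi) (upper_cover phi) <> phi;
        proper_congruence phi /\ meet_irreducible phi /\
          (forall alpha beta : Con A, phi < alpha -> phi < beta ->
             commutator alpha beta <> phi)]) /\
  (* (4) *)
  (finite_set [set: Con A] ->
   [<-> Spec A phi;
        strictly_meet_irreducible phi /\
          commutator (upper_cover phi) (upper_cover phi) <> phi;
        proper_congruence phi /\ meet_irreducible phi /\
          (forall alpha beta : Con A, phi < alpha -> phi < beta ->
             commutator alpha beta <> phi)]).
Proof.
have p1 := @strictly_meet_irreducible_prime S A C phi C_equational C_modular
  A_in_C phi_idem.
have p2 : Spec A phi -> proper_congruence phi /\ meet_irreducible phi /\
    (forall alpha beta : Con A, phi < alpha -> phi < beta ->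
       commutator alpha beta <> phi).
  move=> prime; split; first exact: prime.1.
  split; first exact: prime_meet_irreducible.
  by move=> alpha beta; apply: prime_commutator_neq.
have p3 : finite_set [set gamma : Con A | phi <= gamma] ->
   [<-> Spec A phi;
        strictly_meet_irreducible phi /\
          commutator (upper_cover phi) (upper_cover phi) <> phi;
        proper_congruence phi /\ meet_irreducible phi /\
          (forall alpha beta : Con A, phi < alpha -> phi < beta ->
             commutator alpha beta <> phi)].
  move=> fin.
  (* From (c) to (b): finiteness provides the cover, and the commutator condition is applied with
     both arguments equal to it. *)
  have cb : proper_congruence phi /\ meet_irreducible phi /\
      (forall alpha beta : Con A, phi < alpha -> phi < beta ->
         commutator alpha beta <> phi) ->
      strictly_meet_irreducible phi /\
      commutator (upper_cover phi) (upper_cover phi) <> phi.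
    move=> [proper [irr neq]].
    have smi := finite_strictly_meet_irreducible fin proper irr.
    by split=> //; have [lt _] := upper_coverP smi; apply: neq.
  tfae; [by move=> /p2/cb|by move=> [/p1 p /p/p2]|by move=> /cb[/p1]].
do 3 split=> //.
by move=> fin; apply: p3; apply: sub_finite_set fin.
Qed.
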